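(* Let $(u(r),v(r))$ be an entire radial solution of the system $$\begin{cases}\Delta u=-2e^u+e^v+4e^{2u}-2e^{2v}-e^{u+v}\\ \Delta v=e^u-2e^v-2e^{2u}+4e^{2v}-e^{u+v}\end{cases}\quad\text{in }\mathbb{R}^2$$ (i.e. with $N_1=N_2=0$) which is topological, that is, $(u(r),v(r))\to(0,0)$ as $r\to\infty$. Then $(u(r),v(r))\equiv(0,0)$.
   Context: Here $r=|x|$. An entire radial solution is a pair of functions $u(r),v(r)$ defined for all $r\in(0,\infty)$, satisfying $u_{rr}+\frac1r u_r=-2e^u+e^v+4e^{2u}-2e^{2v}-e^{u+v}$ and $v_{rr}+\frac1r v_r=e^u-2e^v-2e^{2u}+4e^{2v}-e^{u+v}$ on $(0,\infty)$ and remaining bounded, $u(r)=O(1)$, $v(r)=O(1)$, as $r\to0^+$ (so that $u,v$ extend smoothly to $r=0$ with $u_r(0)=v_r(0)=0$). *)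

(* Defs.v *)
From Stdlib Require Import Reals.
From Coquelicot Require Import Coquelicot.
Open Scope R_scope.

(* Laplacian in R^2 of the radial function x |-> u(|x|), at radius r > 0.
   [Derive] is total, so this is meaningful only together with [twice_derivable]. *)
Definition radial_laplacian (u : R -> R) (r : R) : R :=
  Derive (Derive u) r + / r * Derive u r.

Definition twice_derivable (u : R -> R) (r : R) : Prop :=
  ex_derive u r /\ ex_derive (Derive u) r.

(* u(r) = O(1) as r -> 0+ *)
Definition bounded_near_0 (u : R -> R) : Prop :=
  exists M : R, at_right 0 (fun r => Rabs (u r) <= M).

(* A function on (0, oo) is represented by a total function R -> R whose values
   on (-oo, 0] are left unconstrained. *)
Record entire_radial_solution (u v : R -> R) : Prop := {
  ers_regular : forall r, 0 < r -> twice_derivable u r /\ twice_derivable v r;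
  ers_eq_u : forall r, 0 < r ->
    radial_laplacian u r =
      - 2 * exp (u r) + exp (v r) + 4 * exp (2 * u r) - 2 * exp (2 * v r)
      - exp (u r + v r);
  ers_eq_v : forall r, 0 < r ->
    radial_laplacian v r =
      exp (u r) - 2 * exp (v r) - 2 * exp (2 * u r) + 4 * exp (2 * v r)
      - exp (u r + v r);
  ers_bounded_u : bounded_near_0 u;
  ers_bounded_v : bounded_near_0 v
}.

Definition topological (u v : R -> R) : Prop :=
  is_lim u p_infty 0 /\ is_lim v p_infty 0.

(* Main.v *)
Require Import Defs.
From Stdlib Require Import Reals Lra.
From Coquelicot Require Import Coquelicot.
Open Scope R_scope.

(** The system is the gradient system [K^-1 (Delta u, Delta v) = grad W], where
    [K = ((2, -1), (-1, 2))] and the potential [W] is a sum of squares vanishing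
    only at the origin. Hence the energy [E = Q - W], with [Q] the positive
    definite form [<K^-1 (u', v'), (u', v')> / 2], satisfies [E' = - 2 Q / r <= 0].
    Boundedness at the origin forces [u', v' = O(r)], so that [E <= 0] near [0] up
    to [o(1)], while [E >= - W -> 0] at infinity. A nonincreasing function squeezed
    in this way vanishes, so [Q] vanishes and [u], [v] are constant. *)

(** * Mean value tools and bounds on the derivative of a radial function near the origin *)

Lemma derivable_MVT (f df : R -> R) (a b : R) :
  a < b -> (forall x, a <= x <= b -> is_derive f x (df x)) ->
  exists c, a <= c <= b /\ f b - f a = df c * (b - a).
Proof.
intros Hab Hd.
destruct (MVT_gen f a b df) as [c [Hc Heq]].
- rewrite Rmin_left, Rmax_right by lra.
  intros x Hx. apply Hd. lra.
- rewrite Rmin_left, Rmax_right by lra.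
  intros x Hx. apply continuity_pt_filterlim.
  apply (ex_derive_continuous (V := R_NormedModule)).
  exists (df x). now apply Hd.
- rewrite Rmin_left, Rmax_right in Hc by lra. eauto.
Qed.

Lemma nonneg_derive_le (f df : R -> R) (a b : R) :
  a <= b -> (forall x, a <= x <= b -> is_derive f x (df x)) ->
  (forall x, a <= x <= b -> 0 <= df x) -> f a <= f b.
Proof.
intros [Hab | <-] Hd Hp; [| lra].
destruct (derivable_MVT f df a b Hab Hd) as [c [Hc Heq]].
specialize (Hp c Hc). nra.
Qed.

(* If [r u'(r) > C r^2] then [s u'(s)] stays above a positive constant for all
   [s < r], and [u] would diverge logarithmically at [0]. *)
Lemma bounded_radial_derive_le (u du ddu : R -> R) (d M C : R) :
  (forall s, 0 < s < d -> is_derive u s (du s)) ->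
  (forall s, 0 < s < d -> is_derive du s (ddu s)) ->
  (forall s, 0 < s < d -> Rabs (u s) <= M) ->
  (forall s, 0 < s < d -> ddu s + / s * du s <= C) ->
  0 <= C ->
  forall r, 0 < r < d -> du r <= C * r.
Proof.
intros Hu Hdu HM HC HC0 r Hr.
destruct (Rle_or_lt (du r) (C * r)) as [H | H]; [exact H | exfalso].
(* The excess [k], positive by the contradiction hypothesis, is the constant below which [s * du s]
   cannot fall. *)
set (k := r * du r - C * r * r).
assert (Hk : 0 < k) by (unfold k; nra).
assert (Hlow : forall s, 0 < s <= r -> k <= s * du s).
{ intros s Hs.
  (* The derivative of [x * du x] is [x] times the radial Laplacian, at most [C * x <= C * r]; so
     [C * r * x - x * du x] is nondecreasing up to [r]. *)
  assert (Hmono : C * r * s - s * du s <= C * r * r - r * du r).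
  { apply (nonneg_derive_le (fun x => C * r * x - x * du x)
             (fun x => C * r - (du x + x * ddu x))); [lra | |].
    - intros x Hx. assert (Hx' : 0 < x < d) by lra.
      pose proof (is_derive_unique du x (ddu x) (Hdu x Hx')) as E.
      auto_derive.
      + repeat split. exists (ddu x). now apply Hdu.
      + change (Derive (fun t => du t) x) with (Derive du x).
        rewrite E. ring.
    - intros x Hx. assert (Hx' : 0 < x < d) by lra.
      pose proof (HC x Hx') as Hb.
      apply (Rmult_le_compat_l x) in Hb; [| lra].
      replace (x * (ddu x + / x * du x)) with (du x + x * ddu x) in Hb
        by (field; lra).
      nra. }
  assert (0 <= C * r * s) by (repeat apply Rmult_le_pos; lra).
  unfold k. lra. }
(* Chosen so that [k * (ln r - ln s) = 2 * M + 1]: since [du x >= k / x] on [[s, r]], [u] would grow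
   there by more than [2 * M], the most its bound allows. *)
set (s := r * exp (- ((2 * M + 1) / k))).
assert (HM0 : 0 <= M) by (apply Rle_trans with (2 := HM r Hr); apply Rabs_pos).
assert (Ht : 0 < (2 * M + 1) / k) by (apply Rdiv_lt_0_compat; lra).
assert (Hs : 0 < s <= r).
{ pose proof (exp_increasing (- ((2 * M + 1) / k)) 0 ltac:(lra)) as H0.
  rewrite exp_0 in H0.
  pose proof (exp_pos (- ((2 * M + 1) / k))). unfold s. clear - H0 H1 Hr.
  split; [apply Rmult_lt_0_compat | rewrite <- (Rmult_1_r r) at 2; apply Rmult_le_compat_l]; lra. }
assert (Hlog : u s - k * ln s <= u r - k * ln r).
{ apply (nonneg_derive_le (fun x => u x - k * ln x) (fun x => du x - k * / x)); [lra | |].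
  - intros x Hx. assert (Hx' : 0 < x < d) by lra.
    pose proof (is_derive_unique u x (du x) (Hu x Hx')) as E.
    auto_derive.
    + repeat split; [exists (du x); now apply Hu | lra].
    + change (Derive (fun t => u t) x) with (Derive u x).
      rewrite E. field. lra.
  - intros x Hx. assert (Hx' : 0 < x <= r) by lra.
    pose proof (Hlow x Hx') as Hb.
    apply (Rmult_le_compat_l (/ x)) in Hb; [| left; apply Rinv_0_lt_compat; lra].
    replace (/ x * (x * du x)) with (du x) in Hb by (field; lra). lra. }
assert (Hln : k * ln s = k * ln r - (2 * M + 1)).
{ unfold s. rewrite ln_mult by (try apply exp_pos; lra).
  rewrite ln_exp. field. lra. }
assert (Hs' : 0 < s < d) by lra.
pose proof (proj1 (Rabs_le_between (u s) M) (HM s Hs')).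
pose proof (proj1 (Rabs_le_between (u r) M) (HM r Hr)).
lra.
Qed.

(** The hypotheses are symmetric under sign change, so the one-sided estimate applies to both [u]
    and [- u]. *)
Lemma bounded_radial_derive_abs_le (u du ddu : R -> R) (d M C : R) :
  (forall s, 0 < s < d -> is_derive u s (du s)) ->
  (forall s, 0 < s < d -> is_derive du s (ddu s)) ->
  (forall s, 0 < s < d -> Rabs (u s) <= M) ->
  (forall s, 0 < s < d -> Rabs (ddu s + / s * du s) <= C) ->
  0 <= C ->
  forall r, 0 < r < d -> Rabs (du r) <= C * r.
Proof.
intros Hu Hdu HM HC HC0 r Hr.
apply Rabs_le_between.
assert (du r <= C * r).
{ apply (bounded_radial_derive_le u du ddu d M C); auto.
  intros s Hs. now apply Rabs_le_between, HC. }
assert (- du r <= C * r).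
{ apply (bounded_radial_derive_le (fun x => - u x) (fun x => - du x)
           (fun x => - ddu x) d M C); auto.
  - intros s Hs. apply (is_derive_opp u s (du s)). now apply Hu.
  - intros s Hs. apply (is_derive_opp du s (ddu s)). now apply Hdu.
  - intros s Hs. rewrite Rabs_Ropp. now apply HM.
  - intros s Hs. pose proof (proj1 (Rabs_le_between _ _) (HC s Hs)). lra. }
lra.
Qed.

(** By the mean value theorem [f] is constant beyond [r], so its limit at infinity is [f r]. *)
Lemma eq_0_of_derive_0_lim_0 (f df : R -> R) :
  (forall r, 0 < r -> is_derive f r (df r)) -> (forall r, 0 < r -> df r = 0) ->
  is_lim f p_infty 0 -> forall r, 0 < r -> f r = 0.
Proof.
intros Hd H0 Hlim r Hr.
assert (Hc : is_lim f p_infty (f r)).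
{ apply is_lim_ext_loc with (fun _ => f r); [| apply is_lim_const].
  exists r. intros x Hx.
  destruct (derivable_MVT f df r x Hx) as [c [Hcx Heq]].
  - intros y Hy. apply Hd. lra.
  - rewrite H0 in Heq by lra. lra. }
pose proof (is_lim_unique _ _ _ Hlim) as E1.
rewrite (is_lim_unique _ _ _ Hc) in E1. now injection E1.
Qed.

(** * The potential and the kinetic form *)

Definition potential (x y : R) : R :=
  ((exp x - exp y) ^ 2 + (exp x - 1) ^ 2 + (exp y - 1) ^ 2) / 2.

(** This is the form [Q]: the inverse of [K] is [((2, 1), (1, 2)) / 3], and [Q] is half of its
    quadratic form. *)
Definition kinetic (p q : R) : R := (p ^ 2 + p * q + q ^ 2) / 3.

Definition energy (u v : R -> R) (r : R) : R :=
  kinetic (Derive u r) (Derive v r) - potential (u r) (v r).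

Lemma potential_nonneg (x y : R) : 0 <= potential x y.
Proof.
unfold potential.
pose proof (pow2_ge_0 (exp x - exp y)). pose proof (pow2_ge_0 (exp x - 1)).
pose proof (pow2_ge_0 (exp y - 1)). lra.
Qed.

Lemma kinetic_nonneg (p q : R) : 0 <= kinetic p q.
Proof. unfold kinetic. nra. Qed.

Lemma kinetic_eq_0 (p q : R) : kinetic p q = 0 -> p = 0 /\ q = 0.
Proof.
unfold kinetic. intros H.
assert (Rsqr p = 0) by (unfold Rsqr; nra).
assert (Rsqr q = 0) by (unfold Rsqr; nra).
now split; apply Rsqr_0_uniq.
Qed.

Lemma kinetic_le (p q c : R) : Rabs p <= c -> Rabs q <= c -> kinetic p q <= c ^ 2.
Proof.
intros Hp Hq. apply (pow_maj_Rabs _ _ 2) in Hp, Hq.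
unfold kinetic. nra.
Qed.

(** * The energy along a solution *)

Lemma solution_derive (u v : R -> R)
  (Hsol : entire_radial_solution u v) (r : R) : 0 < r ->
  (is_derive u r (Derive u r) /\ is_derive (Derive u) r (Derive (Derive u) r)) /\
  (is_derive v r (Derive v r) /\ is_derive (Derive v) r (Derive (Derive v) r)).
Proof.
intros Hr. destruct (ers_regular _ _ Hsol r Hr) as [[H1 H2] [H3 H4]].
repeat split; now apply Derive_correct.
Qed.

(** Writing [u'' = Delta u - u' / r], and likewise for [v], the Laplacian terms of [Q'] cancel the
    derivative of the potential by the gradient structure; only the friction terms in [1 / r]
    remain. *)
Lemma energy_derive (u v : R -> R)
  (Hsol : entire_radial_solution u v) (r : R) :
  0 < r ->
  is_derive (energy u v) r (- (2 / r * kinetic (Derive u r) (Derive v r))).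
Proof.
intros Hr. destruct (ers_regular _ _ Hsol r Hr) as [[H1 H2] [H3 H4]].
pose proof (ers_eq_u _ _ Hsol r Hr) as Eu.
pose proof (ers_eq_v _ _ Hsol r Hr) as Ev.
unfold radial_laplacian in Eu, Ev.
(* With doubling written as a sum, [exp_plus] makes the equations polynomial in [exp (u r)] and
   [exp (v r)], within reach of [field]. *)
replace (2 * u r) with (u r + u r) in Eu, Ev by ring.
replace (2 * v r) with (v r + v r) in Eu, Ev by ring.
rewrite !exp_plus in Eu, Ev.
unfold energy, kinetic, potential.
auto_derive.
- repeat split; assumption.
- change (Derive (fun x => Derive u x) r) with (Derive (Derive u) r).
  change (Derive (fun x => Derive v x) r) with (Derive (Derive v) r).
  change (Derive (fun x => u x) r) with (Derive u r).
  change (Derive (fun x => v x) r) with (Derive v r).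
  match type of Eu with _ = ?f =>
    replace (Derive (Derive u) r) with (f - / r * Derive u r) by (rewrite <- Eu; ring) end.
  match type of Ev with _ = ?f =>
    replace (Derive (Derive v) r) with (f - / r * Derive v r) by (rewrite <- Ev; ring) end.
  field. lra.
Qed.

Lemma energy_nonincreasing (u v : R -> R)
  (Hsol : entire_radial_solution u v) (r s : R) :
  0 < r <= s -> energy u v s <= energy u v r.
Proof.
intros Hrs.
enough (- energy u v r <= - energy u v s) by lra.
apply (nonneg_derive_le (fun x => - energy u v x)
         (fun x => 2 / x * kinetic (Derive u x) (Derive v x))); [lra | |].
- intros x Hx. rewrite <- (Ropp_involutive (2 / x * _)).
  apply (is_derive_opp (energy u v)). apply (energy_derive u v Hsol). lra.
- intros x Hx. apply Rmult_le_pos; [| apply kinetic_nonneg].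
  left. apply Rdiv_lt_0_compat; lra.
Qed.

(** Near the origin [u] and [v] are bounded, hence so are the right-hand sides of the system, and
    the radial derivative estimate applies to each equation. *)
Lemma solution_derive_O (u v : R -> R)
  (Hsol : entire_radial_solution u v) :
  exists d C, 0 < d /\ 0 <= C /\
  forall r, 0 < r < d -> Rabs (Derive u r) <= C * r /\ Rabs (Derive v r) <= C * r.
Proof.
destruct (ers_bounded_u _ _ Hsol) as [M1 [d1 H1]].
destruct (ers_bounded_v _ _ Hsol) as [M2 [d2 H2]].
set (d := Rmin d1 d2). set (M := Rmax M1 M2).
assert (Hd : 0 < d) by (apply Rmin_pos; apply cond_pos).
assert (Hball : forall (d' : posreal) s, 0 < s < d' -> ball 0 d' s).
{ intros d' s Hs. unfold ball; simpl. unfold AbsRing_ball, abs, minus, plus, opp; simpl.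
  rewrite Rabs_right; lra. }
assert (Hu : forall s, 0 < s < d -> Rabs (u s) <= M).
{ intros s Hs. apply Rle_trans with M1; [| apply Rmax_l].
  apply H1; [| lra]. apply Hball. pose proof (Rmin_l d1 d2). unfold d in Hs. lra. }
assert (Hv : forall s, 0 < s < d -> Rabs (v s) <= M).
{ intros s Hs. apply Rle_trans with M2; [| apply Rmax_r].
  apply H2; [| lra]. apply Hball. pose proof (Rmin_r d1 d2). unfold d in Hs. lra. }
assert (Hexp : forall z, Rabs z <= 2 * M -> 0 < exp z <= exp (2 * M)).
{ intros z Hz. split; [apply exp_pos |].
  apply Rabs_le_between in Hz.
  destruct (Rle_lt_or_eq_dec z (2 * M)) as [Hlt | ->]; [lra | | lra].
  left. now apply exp_increasing. }
assert (Hall : forall s, 0 < s < d ->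
  (0 < exp (u s) <= exp (2 * M) /\ 0 < exp (v s) <= exp (2 * M)) /\
  (0 < exp (2 * u s) <= exp (2 * M) /\ 0 < exp (2 * v s) <= exp (2 * M)) /\
  0 < exp (u s + v s) <= exp (2 * M)).
{ intros s Hs.
  pose proof (proj1 (Rabs_le_between _ _) (Hu s Hs)).
  pose proof (proj1 (Rabs_le_between _ _) (Hv s Hs)).
  split; [split | split; [split |]]; apply Hexp; apply Rabs_le_between; lra. }
(* In each equation the absolute values of the coefficients sum to 10, and every exponential is at
   most [exp (2 * M)]. *)
assert (HC : 0 <= 10 * exp (2 * M)) by (pose proof (exp_pos (2 * M)); lra).
exists d, (10 * exp (2 * M)). split; [exact Hd |]. split; [exact HC |].
intros r Hr. split.
- apply (bounded_radial_derive_abs_le u (Derive u) (Derive (Derive u)) d M); auto.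
  + intros s Hs. now apply (solution_derive u v).
  + intros s Hs. now apply (solution_derive u v).
  + intros s Hs. pose proof (ers_eq_u _ _ Hsol s (proj1 Hs)) as E.
    unfold radial_laplacian in E. rewrite E.
    specialize (Hall s Hs). apply Rabs_le_between. lra.
- apply (bounded_radial_derive_abs_le v (Derive v) (Derive (Derive v)) d M); auto.
  + intros s Hs. now apply (solution_derive u v).
  + intros s Hs. now apply (solution_derive u v).
  + intros s Hs. pose proof (ers_eq_v _ _ Hsol s (proj1 Hs)) as E.
    unfold radial_laplacian in E. rewrite E.
    specialize (Hall s Hs). apply Rabs_le_between. lra.
Qed.

(** For small [s], [E(r) <= E(s) <= Q(s) <= C^2 s^2], which is arbitrarily small. *)
Lemma energy_nonpos (u v : R -> R)
  (Hsol : entire_radial_solution u v) (r : R) :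
  0 < r -> energy u v r <= 0.
Proof.
intros Hr. destruct (solution_derive_O u v Hsol) as [d [C [Hd [HC HO]]]].
apply le_epsilon. intros e He.
(* The bound [r] serves monotonicity, [d / 2] keeps [s] strictly below [d], and the quotient gives
   [C^2 s^2 <= C^2 d s <= e]; the added 1 keeps the denominator positive when [C = 0]. *)
set (s := Rmin (Rmin r (d / 2)) (e / (C ^ 2 * d + 1))).
assert (HCd : 0 < C ^ 2 * d + 1) by nra.
assert (Hs : 0 < s).
{ repeat apply Rmin_pos; try lra. now apply Rdiv_lt_0_compat. }
assert (Hsr : s <= r /\ s <= d / 2).
{ pose proof (Rmin_l (Rmin r (d / 2)) (e / (C ^ 2 * d + 1))).
  pose proof (Rmin_l r (d / 2)). pose proof (Rmin_r r (d / 2)).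
  unfold s. lra. }
assert (Hse : s * (C ^ 2 * d + 1) <= e).
{ apply Rle_div_r; [exact HCd | apply Rmin_r]. }
destruct (HO s) as [Hu Hv]; [lra |].
pose proof (energy_nonincreasing u v Hsol s r ltac:(lra)) as Hmono.
pose proof (kinetic_le _ _ _ Hu Hv).
pose proof (potential_nonneg (u s) (v s)).
assert (C ^ 2 * s * s <= C ^ 2 * s * d)
  by (apply Rmult_le_compat_l; [apply Rmult_le_pos |]; nra).
unfold energy in Hmono at 2. nra.
Qed.

(** For [x > r], [E(r) >= E(x) >= - W(u(x), v(x))], and the right side tends to 0 because [W] is
    continuous and vanishes at the origin. *)
Lemma energy_nonneg (u v : R -> R)
  (Hsol : entire_radial_solution u v) (r : R) :
  topological u v -> 0 < r -> 0 <= energy u v r.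
Proof.
intros [Hu Hv] Hr.
assert (Hexp : forall w, is_lim w p_infty 0 -> is_lim (fun x => exp (w x)) p_infty 1).
{ intros w Hw. rewrite <- exp_0.
  apply (filterlim_comp _ _ _ w exp _ (locally 0)); [exact Hw |].
  apply continuity_pt_filterlim, derivable_continuous_pt, derivable_pt_exp. }
pose proof (Hexp u Hu) as Ha. pose proof (Hexp v Hv) as Hb.
assert (Hlim : is_lim (fun x => - potential (u x) (v x)) p_infty 0).
{ apply (is_lim_ext (fun x => - / 2 *
    ((exp (u x) - exp (v x)) * (exp (u x) - exp (v x))
     + (exp (u x) - 1) * (exp (u x) - 1) + (exp (v x) - 1) * (exp (v x) - 1)))).
  { intros x. unfold potential. field. }
  assert (Hmul0 : forall f, is_lim f p_infty 0 -> is_lim (fun x => f x * f x) p_infty 0).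
  { intros f Hf. rewrite <- (Rmult_0_l 0). now apply (is_lim_mult f f p_infty 0 0). }
  assert (Hsub : forall f g, is_lim f p_infty 1 -> is_lim g p_infty 1 ->
    is_lim (fun x => f x - g x) p_infty 0).
  { intros f g Hf Hg. rewrite <- (Rminus_diag 1). now apply (is_lim_minus' f g p_infty 1 1). }
  assert (H1 : is_lim (fun _ => 1) p_infty 1) by apply is_lim_const.
  replace (Finite 0) with (Rbar_mult (- / 2) (0 + 0 + 0)) by (simpl; f_equal; ring).
  apply is_lim_scal_l.
  apply is_lim_plus'; [apply is_lim_plus' |]; apply Hmul0, Hsub; assumption. }
apply (is_lim_le_loc (fun x => - potential (u x) (v x)) (fun _ => energy u v r)
         p_infty 0 (energy u v r)); [| exact Hlim | apply is_lim_const].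
exists r. intros x Hx.
pose proof (energy_nonincreasing u v Hsol r x ltac:(lra)).
pose proof (kinetic_nonneg (Derive u x) (Derive v x)).
unfold energy in H at 1. lra.
Qed.

Theorem corollary1p4 (u v : R -> R)
  (Hsol : entire_radial_solution u v) (Htop : topological u v) :
  forall r : R, 0 < r -> u r = 0 /\ v r = 0.
Proof.
assert (HE : forall r, 0 < r -> energy u v r = 0).
{ intros r Hr. apply Rle_antisym; [now apply energy_nonpos | now apply energy_nonneg]. }
assert (Hd : forall r, 0 < r -> Derive u r = 0 /\ Derive v r = 0).
{ intros r Hr. apply kinetic_eq_0.
  (* The energy vanishes on the whole neighbourhood [(0, oo)] of [r], so its derivative does too;
     the formula [- 2 Q / r] then forces [Q = 0]. *)
  assert (H0 : Derive (energy u v) r = 0).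
  { rewrite (Derive_ext_loc _ (fun _ => 0)); [apply Derive_const |].
    apply (locally_interval _ r 0 p_infty); simpl; auto. }
  rewrite (is_derive_unique _ _ _ (energy_derive u v Hsol r Hr)) in H0.
  assert (0 < 2 / r) by (apply Rdiv_lt_0_compat; lra).
  pose proof (kinetic_nonneg (Derive u r) (Derive v r)). nra. }
destruct Htop as [Hu Hv].
intros r Hr. split.
- apply (eq_0_of_derive_0_lim_0 u (Derive u)); auto.
  + intros s Hs. now apply (solution_derive u v).
  + intros s Hs. now apply Hd.
- apply (eq_0_of_derive_0_lim_0 v (Derive v)); auto.
  + intros s Hs. now apply (solution_derive u v).
  + intros s Hs. now apply Hd.
Qed.
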